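(* Let $A$ be a finite set, let $G$ be a finitely generated one-ended group, and let $H$ be a discrete group. Then every continuous cocycle $c:G\times A^G\to H$ over the full shift $A^G$ is cohomologous to a homomorphism; that is, there exist a continuous function $b:A^G\to H$ and a group homomorphism $\phi:G\to H$ such that $c(g,x)=b(gx)\,\phi(g)\,b(x)^{-1}$ for all $g\in G$ and $x\in A^G$.
   Context: The set $A$ carries the discrete topology. The full shift $A^G$ is the set of all functions $G\to A$ with the product topology and the left $G$-action $(gx)(h)=x(g^{-1}h)$. $G$ and $H$ carry the discrete topology. A continuous $H$-valued cocycle over $A^G$ is a continuous function $c:G\times A^G\to H$ such that $c(gh,x)=c(g,hx)\,c(h,x)$ for all $g,h\in G$, $x\in A^G$. Continuity means: for every $g\in G$, the function $x\mapsto c(g,x)$ is continuous on $A^G$, i.e. there is a finite $F\subseteq G$ (depending on $g$) such that $x|_F=y|_F$ implies $c(g,x)=c(g,y)$. One-endedness: let $\mathcal{S}$ be a finite symmetric generating set of $G$, $|g|$ the corresponding word norm, $B(n,1_G)=\{g\in G:|g|\le n\}$, and $\mathrm{Cay}_{\mathcal{S}}G$ the Cayley graph (with vertices $g,h$ adjacent iff $g^{-1}h\in\mathcal{S}$). The number of ends of $G$ is the limit as $n\to\infty$ of the number of unbounded connected components of $\mathrm{Cay}_{\mathcal{S}}G\setminus B(n,1_G)$; $G$ is one-ended if this number is $1$. *)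

(* Defs.v *)
From HB Require Import structures.
From mathcomp Require Import all_boot all_order finmap.
From mathcomp Require Import all_classical topology.

Set Implicit Arguments.
Unset Strict Implicit.
Unset Printing Implicit Defensive.

Local Open Scope classical_set_scope.
Local Open Scope group_scope.

Section Ends.
Variable G : groupType.
Implicit Types (S X : set G) (g h : G) (n : nat).

Definition generates S : Prop :=
  smallest [set K : set G | group_closed [in K]] S = [set: G].

Definition finitely_generated : Prop :=
  exists S, finite_set S /\ generates S.

Definition finite_symmetric_generating S : Prop :=
  [/\ finite_set S, (forall s, S s -> S s^-1) & generates S].

(* For a symmetric generating set the set below is nonempty, so that its
   infimum in nat is its least element; inverses of generators need not be
   allowed explicitly because S is symmetric. *)
Definition word_norm S g : nat :=
  infimum 0%N [set size s | s in
    [set s : seq G | {subset s <= S} /\ g = \prod_(x <- s) x]].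

Definition word_ball S n : set G := [set g | word_norm S g <= n]%N.

Definition cayley_edge S : rel G := fun g h => g^-1 * h \in S.

(* The component of g in the subgraph induced on X, for g in X. *)
Definition cayley_component S X g : set G :=
  [set h | exists p : seq G,
    [/\ path (cayley_edge S) g p, {subset g :: p <= X} & last g p = h]].

Definition unbounded S X : Prop := ~ exists n, X `<=` word_ball S n.

Definition unbounded_components S X : set (set G) :=
  [set C | (exists2 g, X g & C = cayley_component S X g) /\ unbounded S C].

(* fset_set sends an infinite set to the empty one; this plays no role here,
   since the complement of a ball in a locally finite connected graph has only
   finitely many components. *)
Definition num_unbounded_components S n : nat :=
  #|` fset_set (unbounded_components S (~` word_ball S n))|.

(* The number of ends does not depend on the finite symmetric generating set. *)
Definition one_ended : Prop :=
  exists S, finite_symmetric_generating S /\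
    num_unbounded_components S n @[n --> \oo] --> 1%N.

End Ends.

Arguments finitely_generated : clear implicits.
Arguments one_ended : clear implicits.

Definition full_shift (A : choiceType) (G : groupType) : topologicalType :=
  prod_topology (fun _ : G => discrete_topology A).

Definition shift (A : choiceType) (G : groupType) (g : G)
  (x : full_shift A G) : full_shift A G := fun h => x (g^-1 * h).

(* Since G is discrete, continuity of c on G * A^G amounts to continuity of
   each c g. *)
Definition continuous_cocycle (A : choiceType) (G H : groupType)
    (c : G -> full_shift A G -> discrete_topology H) : Prop :=
  (forall g, continuous (c g)) /\
  (forall g h x, c (g * h) x = (c g (shift h x) : H) * c h x).

(* Main.v *)
Require Import Defs.
From HB Require Import structures.
From mathcomp Require Import all_boot all_order finmap.
From mathcomp Require Import all_classical topology.

Local Open Scope group_scope.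

(** Fix a symmetric generating set [S]. Writing [g] for a vertex of the Cayley
graph, the cocycle identity gives
[c (g * s)^-1 x = c s^-1 (shift g^-1 x) * c g^-1 x], and the first factor
depends only on the values of [x] near [g], because a continuous function on
the full shift has a finite window ([finite_window]). So [c g^-1 x] is a
product of local contributions collected along any walk from [1] to [g].

Let [x] and [y] differ at finitely many sites. Their contributions agree away
from these sites, so [ratio g x y = (c g^-1 x)^-1 * c g^-1 y] does not change
along walks avoiding a finite set. As [G] has one end, the ratio is therefore
constant for [g] outside a finite set; call its value there [Phi x y]. It is
multiplicative, [Phi x y * Phi y z = Phi x z], and equivariant,
[Phi (g x) (g y) = c g x * Phi x y * (c g y)^-1]. For a constant configuration
[x0], which every shift fixes, this equivariance says that [b x := Phi x x0],
defined when [x] differs from [x0] at finitely many sites, satisfies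
[c g x = b (g x) * c g x0 * (b x)^-1], and [g |-> c g x0] is a homomorphism.

It remains to extend [b] continuously from the configurations asymptotic to
[x0] to all of them, that is, to see that [b] depends on finitely many
coordinates. If [x] and [y] differ at a single site [d], the obstacle that
walks must avoid is the translate by [d] of a fixed finite set. For all but
finitely many [d] the vertex [1] then lies in the part of the graph where the
ratio takes its limit value, and the ratio at [1] is trivial; so [Phi x y = 1]
([ratio_limit_one_site]). Changing sites one at a time, [Phi x y = 1] as soon
as [x] and [y] agree on a fixed finite set [F]. Hence [b] may be computed after
truncating [x] to [F]. *)

(** * Finite windows of continuous functions on the full shift *)

Section Cylinders.
Local Open Scope classical_set_scope.
Import ArrowAsProduct.
Variables (G : groupType) (A : choiceType).
Implicit Types (x y : full_shift A G) (F : seq G).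

(** The supremum of the initial topologies of the coordinates is the coarsest
for which all coordinates converge, and they do converge along the filter of
cylinders around [x]; that filter is thus finer than [nbhs x]. *)
Lemma nbhs_sub_cylinder {x} {U : set (full_shift A G)} :
  nbhs x U -> exists F, forall y, {in F, x =1 y} -> U y.
Proof.
pose cyl F : set (full_shift A G) := [set y | {in F, x =1 y}].
have cylF : Filter (filter_from setT cyl).
  apply: filter_from_filter; first by exists [::].
  move=> F1 F2 _ _; exists (F1 ++ F2) => // y xy.
  by split=> g gF; apply: xy; rewrite mem_cat gF ?orbT.
suff cylx : filter_from setT cyl --> x.
  by move=> /cylx[F _ FU]; exists F.
apply/cvg_sup => g.
have coord_surj (a : A) : exists y : full_shift A G, y g = a.
  by exists (fun h => if h == g then a else x h); rewrite eqxx.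
apply/cvg_image.
  by apply/seteqP; split=> [//|a] _; have [y ya] := coord_surj a; exists y.
move=> V Vx; exists [set y | V (y g)].
  exists [:: g] => // y xy /=.
  by rewrite -xy ?mem_head //; exact: nbhs_singleton Vx.
apply/seteqP; split=> [_ [y Vy <-] //|a Va] /=.
by have [y ya] := coord_surj a; exists y; rewrite ya.
Qed.

Lemma cylinder_nbhs x F : nbhs x [set y | {in F, x =1 y}].
Proof.
elim: F => [|g F IHF]; first exact: filterE.
have xg : nbhs x [set y : full_shift A G | x g = y g].
  have := @proj_continuous G (fun=> discrete_topology A) g x [set a | x g = a].
  by apply; apply/principal_filterP.
apply: (filterS _ (filterI xg IHF)) => y [xyg xyF] h.
by rewrite inE => /orP[/eqP->|/xyF].
Qed.
End Cylinders.

Section ContinuousFunctions.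
Local Open Scope classical_set_scope.
Import ArrowAsProduct.
Variables (G : groupType) (A : finType) (T : choiceType).
Implicit Types (x y : full_shift A G) (F : seq G).

(** Compactness makes the window uniform: otherwise the points at which [F]
fails to determine [f], with [F] finite, generate a proper filter. It clusters
at some [p], contradicting that [f] is constant on a cylinder around [p]. *)
Lemma finite_window {f : full_shift A G -> discrete_topology T} :
  continuous f ->
  exists F, forall x y, {in F, x =1 y} -> f x = f y.
Proof.
move=> cf; apply: contrapT => noF.
pose bad F : set (full_shift A G) :=
  [set x : full_shift A G |
    exists2 y : full_shift A G, {in F, x =1 y} & f x <> f y].
have badF : ProperFilter (filter_from setT bad).
  apply: filter_from_proper.
    apply: filter_from_filter; first by exists [::].
    move=> F1 F2 _ _; exists (F1 ++ F2) => // x [y xy fxy].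
    by split; exists y => // g gF; apply: xy; rewrite mem_cat gF ?orbT.
  move=> F _; apply: contrapT => bad0; apply: noF; exists F => x y xy.
  by apply: contrapT => fxy; apply: bad0; exists x, y.
have finA : finite_set [set: discrete_topology A].
  exact: (@finite_finset A).
have [|p [_ clp]] := @tychonoff G (fun=> discrete_topology A) (fun=> setT)
    (fun=> finite_compact finA) _ badF.
  by exists [::].
have /nbhs_sub_cylinder[F Fp] : nbhs p [set y | f p = f y].
  have := cf p [set a | f p = a]; apply; exact/principal_filterP.
have [||x [[y xy fxy] px]] := clp (bad F) [set y | {in F, p =1 y}].
- by exists F.
- exact: cylinder_nbhs.
by apply: fxy; rewrite -(Fp x) // -(Fp y) // => g gF; rewrite px ?xy.
Qed.

Lemma local_continuous {f : full_shift A G -> discrete_topology T} F :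
  (forall x y, {in F, x =1 y} -> f x = f y) -> continuous f.
Proof.
move=> fF x V /principal_filterP Vfx.
suff : nbhs x (f @^-1` V) by [].
apply: filterS (cylinder_nbhs _ _ x F) => y /fF fxy.
by rewrite /preimage /= -fxy.
Qed.
End ContinuousFunctions.

(** * Walks and components in a one-ended Cayley graph *)

Section Walks.
Variable G : groupType.
Implicit Types (S X : set G) (g h : G) (K E : seq G).
Local Open Scope classical_set_scope.

Lemma component_refl S X g : X g -> cayley_component S X g g.
Proof.
by move=> Xg; exists [::]; split=> // h; rewrite inE => /eqP->; exact: mem_set.
Qed.

Lemma component_trans {S X g h k} : cayley_component S X g h ->
  cayley_component S X h k -> cayley_component S X g k.
Proof.
move=> [p [pS pX <-]] [q [qS qX qk]]; exists (p ++ q); split.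
- by rewrite cat_path pS.
- move=> l; rewrite -cat_cons mem_cat => /orP[/pX //|lq].
  by apply: qX; rewrite inE lq orbT.
- by rewrite last_cat.
Qed.

Lemma component_edge S X g h s :
  cayley_component S X g h -> S s -> X (h * s) ->
  cayley_component S X g (h * s).
Proof.
move=> [p [pS pX <-]] Ss Xhs; exists (rcons p (last g p * s)); split.
- by rewrite rcons_path pS /cayley_edge mulKg; exact: mem_set.
- move=> k; rewrite -rcons_cons mem_rcons inE => /orP[/eqP->|/pX //].
  exact: mem_set.
- by rewrite last_rcons.
Qed.

Lemma eq_on_component {T : Type} {S X} {f : G -> T} {g h} :
  (forall k s, X k -> S s -> f (k * s) = f k) ->
  cayley_component S X g h -> f h = f g.
Proof.
move=> fS [p [pS pX <-]]; elim: p g pS pX => //= k p IHp g /andP[gk pS] gpX.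
rewrite IHp //; last by move=> l lp; apply: gpX; rewrite inE lp orbT.
have -> : k = g * (g^-1 * k) by rewrite mulVKg.
apply: fS; last exact: set_mem.
by apply: set_mem; apply: gpX; rewrite mem_head.
Qed.

Lemma generatesP S g : finite_symmetric_generating S ->
  exists2 s : seq G, {subset s <= S} & g = \prod_(x <- s) x.
Proof.
move=> [_ symS genS].
pose P : set G := [set h | exists2 s : seq G,
  {subset s <= S} & h = \prod_(x <- s) x].
suff : [set: G] `<=` P by apply.
rewrite -genS; apply: smallest_sub; last first.
  move=> s Ss; exists [:: s]; last by rewrite big_seq1.
  by move=> h; rewrite inE => /eqP->; exact: mem_set.
split; first by apply: mem_set; exists [::]; rewrite ?big_nil.
move=> _ _ /set_mem[s sS ->] /set_mem[t tS ->]; apply: mem_set.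
elim/last_ind: t tS s sS => [|t k IHt] tS s sS.
  by exists s => //; rewrite big_nil divg1.
have Sk : S k by apply: set_mem; apply: tS; rewrite mem_rcons mem_head.
have [||r rS rE] := IHt _ (rcons s k^-1).
- by move=> h ht; apply: tS; rewrite mem_rcons inE ht orbT.
- move=> h; rewrite mem_rcons inE => /orP[/eqP->|/sS //].
  exact/mem_set/symS.
by exists r; rewrite // -rE !big_rcons /= invgM mulgA.
Qed.

Lemma nat_infimum_mem {I : set nat} : I !=set0 -> I (infimum 0%N I).
Proof.
move=> [m Im].
have exI : exists n, n \in I by exists m; exact: mem_set.
case: (ex_minnP exI) => n /set_mem In n_min.
rewrite /infimum; case: eqP => [I0|_]; first by rewrite I0 in Im.
case: xgetP => [k _ [kl ku]|/(_ n)[]].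
  suff -> : k = n by [].
  apply/eqP; rewrite eqn_leq; apply/andP; split; first exact: kl.
  by apply: ku => l /mem_set/n_min.
by split=> [k /mem_set/n_min|k] //; exact.
Qed.

Lemma word_normP S g : finite_symmetric_generating S ->
  exists s : seq G, [/\ {subset s <= S}, g = \prod_(x <- s) x
    & size s = word_norm S g].
Proof.
move=> fsgS; have [s sS gs] := generatesP S g fsgS.
have [|t [tS gt] tsz] := @nat_infimum_mem [set size s | s in
    [set s : seq G | {subset s <= S} /\ g = \prod_(x <- s) x]].
  by exists (size s); exists s.
by exists t.
Qed.

(** The word norm is attained, so the elements of a ball are products of
boundedly many generators. *)
Lemma finite_word_ball S n : finite_symmetric_generating S ->
  finite_set (word_ball S n).
Proof.
move=> fsgS; have [finS _ _] := fsgS.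
pose P m : set G := [set g | exists s : seq G, [/\ {subset s <= S},
  g = \prod_(x <- s) x & (size s <= m)%N]].
apply: (@sub_finite_set _ _ (P n)) => [g gn|].
  by have [s [sS gs szs]] := word_normP S g fsgS; exists s; rewrite szs.
elim: n => [|n IHn].
  apply: (@sub_finite_set _ _ [set 1]); last exact: finite_set1.
  by move=> g [[|? ?] [_ -> //]]; rewrite big_nil.
apply: (@sub_finite_set _ _ (1 |` [set s * g | s in S & g in P n])).
  move=> g [[|s t] [tS -> szt]]; first by left; rewrite big_nil.
  rewrite big_cons; right; exists s.
    by apply: set_mem; apply: tS; rewrite mem_head.
  exists (\prod_(x <- t) x) => //.
  by exists t; split=> // h ht; apply: tS; rewrite inE ht orbT.
by rewrite finite_setU; split=> //; exact: finite_image2.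
Qed.

Lemma seq_sub_word_ball S K : exists N, forall n, (N <= n)%N ->
  [set` K] `<=` word_ball S n.
Proof.
exists (\max_(g <- K) word_norm S g) => n Kn g /= gK.
by apply: leq_trans Kn; exact: leq_bigmax_seq.
Qed.

Lemma finite_set_seq {X} : finite_set X -> exists K, [set` K] = X.
Proof. by move=> /finite_seqP[K ->]; exists K. Qed.

Lemma unbounded_exists_notin {S X} K : unbounded S X ->
  exists2 g, X g & g \notin K.
Proof.
move=> ubX; apply: contrapT => noX; apply: ubX.
have [n Kn] := seq_sub_word_ball S K; exists n => g Xg.
by apply: (Kn n) => //=; case: (boolP (g \in K)) => // gK; case: noX; exists g.
Qed.

(** An eventually constant sequence of naturals: as soon as the ball is large,
there is exactly one unbounded component. The value [1] also excludes an
infinite set of components, to which [fset_set] would assign cardinal [0]. *)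
Lemma one_ended_unbounded_component : one_ended G ->
  exists2 S, finite_symmetric_generating S & forall K, exists n C,
    [set` K] `<=` word_ball S n /\
    unbounded_components S (~` word_ball S n) = [set C].
Proof.
move=> [S [fsgS lim1]]; exists S => // K.
have [m Km] := seq_sub_word_ball S K.
have [N _ N1] : \forall n \near \oo, num_unbounded_components S n = 1%N.
  exact: (lim1 [set 1%N]).
pose n := maxn m N; exists n.
have /N1 : (N <= n)%N by exact: leq_maxr.
rewrite /num_unbounded_components.
set UC := unbounded_components _ _ => UC1.
have finUC : finite_set UC.
  apply: contrapT => infUC; move: UC1; rewrite /fset_set.
  by case: pselect.
move/eqP: UC1 => /cardfs1P[C UCC]; exists C; split.
  by apply: Km; exact: leq_maxl.
by rewrite -(fset_setK finUC) UCC set_fset1.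
Qed.

Lemma one_ended_infinite K : one_ended G -> exists g, g \notin K.
Proof.
move=> /one_ended_unbounded_component[S _ /(_ [::])[n [C [_ UC]]]].
have [_ ubC] : unbounded_components S (~` word_ball S n) C by rewrite UC.
by have [g _ gK] := unbounded_exists_notin K ubC; exists g.
Qed.

Lemma component_subset {S X Y} g : X `<=` Y ->
  cayley_component S X g `<=` cayley_component S Y g.
Proof.
move=> XY h [p [pS pX ph]]; exists p; split=> // k /pX /set_mem Xk.
exact/mem_set/XY.
Qed.

(** Follow a word for [g] from [1], which is outside [X], and restart the walk
at each entrance into [X]: the last one is the boundary vertex [e]. *)
Lemma component_reaches_boundary S X g : finite_symmetric_generating S ->
  ~ X 1 -> X g -> exists2 e, (X `&` [set h * s | h in ~` X & s in S]) e &
    cayley_component S X e g.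
Proof.
move=> fsgS X1; have [s sS ->] := generatesP S g fsgS.
elim/last_ind: s sS => [|s k IHs] sS; first by rewrite big_nil.
have Sk : S k by apply: set_mem; apply: sS; rewrite mem_rcons mem_head.
rewrite big_rcons /=; set h := \prod_(x <- s) x in IHs *.
move=> Xhk; case: (pselect (X h)) => Xh.
  have [|//|e eB eh] := IHs.
    by move=> l ls; apply: sS; rewrite mem_rcons inE ls orbT.
  by exists e => //; exact: component_edge eh Sk Xhk.
exists (h * k); last exact: component_refl.
by split=> //; exists h => //; exists k.
Qed.

(** One-endedness in the form used for cocycles. Outside a large ball there is
one unbounded component. Every component meets the finite boundary of the
ball, so there are finitely many bounded ones, each of them finite; together
with the ball they form the exceptional set [E]. *)
Lemma one_ended_connected_at_infinity : one_ended G ->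
  exists2 S, finite_symmetric_generating S & forall K, exists g0 E,
    forall g, g \notin E -> cayley_component S (~` [set` K]) g0 g.
Proof.
move=> /one_ended_unbounded_component[S fsgS oneC]; exists S => // K.
(* The ball contains 1, so that walks issued from 1 start outside X. *)
have [n [C [Kn UC]]] := oneC (1 :: K).
have finS : finite_set S by case: fsgS.
set X := ~` word_ball S n in UC.
have [[g0 _ Cg0] _] : unbounded_components S X C by rewrite UC.
have X1 : ~ X 1 by apply; apply: Kn; exact: mem_head.
pose B := X `&` [set h * s | h in ~` X & s in S].
have finB : finite_set B.
  apply: finite_setIr; apply: finite_image2 => //.
  by rewrite setCK; exact: finite_word_ball.
have [E EE] : exists E, [set` E] = word_ball S n `|`
    \bigcup_(e in B `\` C) cayley_component S X e.
  apply: finite_set_seq; rewrite finite_setU; split.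
    exact: finite_word_ball.
  apply: bigcup_finite => [|e [[Xe _] Ce]]; first exact: finite_setD.
  have [ub|/contrapT[m em]] := pselect (unbounded S (cayley_component S X e)).
    have : unbounded_components S X (cayley_component S X e).
      by split=> //; exists e.
    by rewrite UC => eC; case: Ce; rewrite -eC; exact: component_refl.
  exact: sub_finite_set em (finite_word_ball S m fsgS).
exists g0, E => g gE.
have {gE} : ~ (word_ball S n `|`
    \bigcup_(e in B `\` C) cayley_component S X e) g.
  by rewrite -EE; apply/negP.
move=> /not_orP[gn gU].
apply: (@component_subset _ X).
  by apply: subsetC => k kK; apply: Kn; rewrite /= inE kK orbT.
have [e eB eg] := component_reaches_boundary S X g fsgS X1 gn.
have Ce : C e by apply: contrapT => Ce; apply: gU; exists e.
by rewrite Cg0 in Ce; exact: component_trans Ce eg.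
Qed.
End Walks.

(** * Limits of cocycle ratios on asymptotic configurations *)

(** Interpolates between two functions that differ at finitely many sites by
changing one site at a time, at each site where they may differ. *)
Lemma finite_change_ind {I : eqType} {T : Type}
    (R : (I -> T) -> (I -> T) -> Prop) (P : I -> Prop) :
  (forall x, R x x) -> (forall x y z, R x y -> R y z -> R x z) ->
  (forall d x y, P d -> (forall h, h != d -> x h = y h) -> R x y) ->
  forall (D : seq I) x y, {in D, forall d, P d} ->
  (forall h, h \notin D -> x h = y h) -> R x y.
Proof.
move=> Rxx Rtrans R1; elim=> [|d D IHD] x y PD xy.
  by have -> : x = y by apply/funext => h; apply: xy.
apply: (Rtrans _ (fun h => if h == d then y h else x h)).
  by apply: (R1 d) => [|h /negPf-> //]; apply: PD; exact: mem_head.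
apply: IHD => [e eD|h hD]; first by apply: PD; rewrite inE eD orbT.
by case: eqP => // /eqP hd; apply: xy; rewrite inE negb_or hd.
Qed.

Section Cocycle.
Variables (A : finType) (G H : groupType).
Variable c : G -> full_shift A G -> H.
Hypothesis cM : forall g h x, c (g * h) x = c g (shift h x) * c h x.
Implicit Types (x y z : full_shift A G) (g h : G) (u v : H) (D E F K : seq G).

(** The inverse turns the left action on configurations into right
multiplication on vertices: the ratio at [g * s] differs from the ratio at [g]
by a contribution of the coordinates near [g]. *)
Definition ratio g x y : H := (c g^-1 x)^-1 * c g^-1 y.

(** The limit along the filter of cofinite sets, for the discrete topology of
[H]. *)
Definition ratio_limit x y u : Prop :=
  exists K, forall g, g \notin K -> ratio g x y = u.

Lemma cocycle1 x : c 1 x = 1.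
Proof.
have shift1 : shift 1 x = x by apply/funext => h; rewrite /shift invg1 mul1g.
by apply: (mulgI (c 1 x)); rewrite mulg1 -{1}shift1 -cM mulg1.
Qed.

Lemma ratio_shift g h x y :
  ratio h (shift g x) (shift g y) = c g x * ratio (g^-1 * h) x y * (c g y)^-1.
Proof.
by rewrite /ratio invgM invgK !cM invgM !mulgA mulgV mul1g mulgK.
Qed.

Lemma ratio_limit_refl x : ratio_limit x x 1.
Proof. by exists [::] => g _; rewrite /ratio mulVg. Qed.

Lemma ratio_limit_trans {x y z u v} :
  ratio_limit x y u -> ratio_limit y z v -> ratio_limit x z (u * v).
Proof.
move=> [K Ku] [L Lv]; exists (K ++ L) => g; rewrite mem_cat => /norP[gK gL].
by rewrite -(Ku g gK) -(Lv g gL) /ratio mulgA mulgK.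
Qed.

Lemma ratio_limit_shift g {x y u} : ratio_limit x y u ->
  ratio_limit (shift g x) (shift g y) (c g x * u * (c g y)^-1).
Proof.
move=> [K Ku]; exists [seq g * k | k <- K] => h hK.
rewrite ratio_shift Ku //; apply: contra hK => hK.
by apply/mapP; exists (g^-1 * h); rewrite ?mulVKg.
Qed.

(** Cofinite sets meet, since [G] is infinite. *)
Lemma ratio_limit_unique {x y u v} : one_ended G ->
  ratio_limit x y u -> ratio_limit x y v -> u = v.
Proof.
move=> oneG [K Ku] [L Lv]; have [g] := one_ended_infinite G (K ++ L) oneG.
by rewrite mem_cat => /norP[/Ku <- /Lv <-].
Qed.

(** Crossing the edge from [g] to [g * s] multiplies [c g^-1 x] and
[c g^-1 y] on the left by the same element when [x] and [y] agree on the window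
translated to [g]; it cancels in the ratio. *)
Lemma ratio_step {W : seq G} g s {x y} :
  (forall x y, {in W, x =1 y} -> c s^-1 x = c s^-1 y) ->
  (forall w, w \in W -> x (g * w) = y (g * w)) ->
  ratio (g * s) x y = ratio g x y.
Proof.
move=> cW xy; rewrite /ratio !invgM !cM.
rewrite (cW (shift g^-1 x) (shift g^-1 y)); last first.
  by move=> w wW; rewrite /shift invgK xy.
by rewrite invgM -!mulgA mulKg.
Qed.

Lemma common_window (S : set G) : finite_set S ->
  (forall s, continuous (c s : full_shift A G -> discrete_topology H)) ->
  exists W : seq G, forall s, S s ->
    forall x y, {in W, x =1 y} -> c s x = c s y.
Proof.
move=> /finite_set_seq[K <-] cont.
elim: K => [|s K [W IHW]]; first by exists [::] => s; rewrite /= in_nil.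
have [V sV] := finite_window _ _ _ (cont s).
exists (V ++ W) => t; rewrite /= inE => /orP[/eqP->|tK] x y xy.
  by apply: sV => g gV; apply: xy; rewrite mem_cat gV.
by apply: IHW => // g gW; apply: xy; rewrite mem_cat gW orbT.
Qed.

(** The only edges that may change the ratio start at vertices [d * w^-1], with
[w] in the window. In the coordinate [k = d^-1 * g] this obstacle, and so the
finite set [E] outside of which the ratio is constant, does not depend on [d].
The vertex [1] has coordinate [d^-1], and the ratio is trivial there: the limit
is [1] unless [d^-1] is in [E]. *)
Lemma ratio_limit_one_site : one_ended G ->
  (forall g, continuous (c g : full_shift A G -> discrete_topology H)) ->
  exists F, forall d x y, (forall h, h != d -> x h = y h) ->
    exists u, ratio_limit x y u /\ (d \notin F -> u = 1).
Proof.
move=> oneG cont.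
have [S fsgS conn] := one_ended_connected_at_infinity G oneG.
have [finS symS _] := fsgS.
have [W cW] := common_window S finS cont.
have [k0 [E kE]] := conn [seq w^-1 | w <- W].
exists [seq k^-1 | k <- E] => d x y xy.
have ratioE k : k \notin E -> ratio (d * k) x y = ratio (d * k0) x y.
  move=> /kE; apply: (eq_on_component G (f := fun k => ratio (d * k) x y)).
  move=> l s lW Ss; rewrite mulgA; apply: (@ratio_step W) => [|w wW].
    exact/cW/symS.
  apply: xy; apply/eqP => dlw; apply: lW => /=; apply/mapP; exists w => //.
  by rewrite -[l](mulgK w) -[l * w](mulKg d) (mulgA d) dlw mulVg mul1g.
exists (ratio (d * k0) x y); split.
  exists [seq d * k | k <- E] => g gE.
  rewrite -(mulVKg d g) ratioE //; apply: contra gE => gE.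
  by apply/mapP; exists (d^-1 * g); rewrite ?mulVKg.
move=> dE; rewrite -(ratioE d^-1).
  by rewrite mulgV /ratio invg1 !cocycle1 mulVg.
by apply: contra dE => dE; apply/mapP; exists d^-1; rewrite ?invgK.
Qed.

(** The transfer function at [x] is the limit ratio between the truncation of
[x] to [F] and the constant configuration [x0], where changes outside of [F]
have trivial limit ratio. *)
Theorem cocycle_trivialization (a : A) : one_ended G ->
  (forall g, continuous (c g : full_shift A G -> discrete_topology H)) ->
  exists b : full_shift A G -> H,
    continuous (b : full_shift A G -> discrete_topology H) /\
    forall g x, c g x = b (shift g x) * c g (fun=> a) * (b x)^-1.
Proof.
move=> oneG cont.
have [F F1] := ratio_limit_one_site oneG cont.
have lim_ex D x y : (forall h, h \notin D -> x h = y h) ->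
    exists u, ratio_limit x y u.
  move=> Dxy; apply: (@finite_change_ind G A
    (fun x y => exists u, ratio_limit x y u) (fun=> True)
    _ _ _ D x y _ Dxy) => //.
  - by move=> z; exists 1; exact: ratio_limit_refl.
  - move=> x1 x2 x3 [u u12] [v v23]; exists (u * v).
    exact: ratio_limit_trans u12 v23.
  - by move=> d x1 x2 _ x12; have [u [? _]] := F1 d x1 x2 x12; exists u.
have lim1 D x y : {in D, forall d, d \notin F} ->
    (forall h, h \notin D -> x h = y h) -> ratio_limit x y 1.
  move=> DF Dxy; apply: (@finite_change_ind G A
    (fun x y => ratio_limit x y 1) (fun d => d \notin F) _ _ _ D x y DF Dxy).
  - exact: ratio_limit_refl.
  - move=> x1 x2 x3 l12 l23; rewrite -(mulg1 1).
    exact: ratio_limit_trans l12 l23.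
  - move=> d x1 x2 dF x12; have [u [lu u1]] := F1 d x1 x2 x12.
    by rewrite -(u1 dF).
pose x0 : full_shift A G := fun=> a.
pose patch K x : full_shift A G := fun h => if h \in K then x h else a.
have patch_eq K x y : {in K, x =1 y} -> patch K x = patch K y.
  by move=> xy; apply/funext => h; rewrite /patch; case: ifP => // /xy.
have patch_in K x : {in K, patch K x =1 x} by move=> h hK; rewrite /patch hK.
have patch_out K x h : h \notin K -> patch K x h = x0 h.
  by move=> /negPf hK; rewrite /patch hK.
have [b bP] := choice (fun x => lim_ex F (patch F x) x0 (patch_out F x)).
have b_eq x y : {in F, x =1 y} -> b x = b y.
  move=> xy; apply: (ratio_limit_unique oneG (bP x)).
  by rewrite (patch_eq _ _ _ xy).
(* On configurations asymptotic to x0 the truncation is immaterial. *)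
have b_lim D x : (forall h, h \notin D -> x h = x0 h) -> ratio_limit x x0 (b x).
  move=> Dx; rewrite -[b x]mul1g; apply: ratio_limit_trans (bP x).
  apply: (lim1 [seq d <- D | d \notin F]) => [d|h].
    by rewrite mem_filter => /andP[].
  rewrite mem_filter negb_and negbK => /orP[hF|hD]; first by rewrite patch_in.
  by rewrite /patch; case: ifP => // _; exact: Dx.
exists b; split; first exact: (local_continuous _ _ _ F).
move=> g x; have [V gV] := finite_window _ _ _ (cont g).
(* Both sides see x only on K, so x may be replaced by an asymptotic y. *)
pose K := F ++ V ++ [seq g^-1 * f | f <- F].
pose y := patch K x.
have yx : {in K, y =1 x} := patch_in K x.
have -> : c g x = c g y by apply: gV => h hV; rewrite yx // !mem_cat hV orbT.
have -> : b x = b y by apply: b_eq => h hF; rewrite yx // mem_cat hF.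
have -> : b (shift g x) = b (shift g y).
  apply: b_eq => h hF; rewrite /shift yx // !mem_cat map_f ?orbT //.
have y0 : ratio_limit y x0 (b y) := b_lim K y (patch_out K x).
have gy0 : ratio_limit (shift g y) x0 (b (shift g y)).
  apply: (b_lim [seq g * k | k <- K]) => h hK; rewrite /shift /y patch_out //.
  by apply: contra hK => hK; apply/mapP; exists (g^-1 * h); rewrite ?mulVKg.
rewrite (ratio_limit_unique oneG gy0 (ratio_limit_shift g y0)).
by rewrite mulgVK mulgK.
Qed.
End Cocycle.

Theorem theorem1p2 (A : finType) (G H : groupType)
    (fgG : finitely_generated G) (oneG : one_ended G)
    (c : G -> full_shift A G -> discrete_topology H)
    (cc : continuous_cocycle c) :
  exists (b : full_shift A G -> discrete_topology H)
         (phi : {multiplicative G -> H}),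
    continuous b /\
    forall (g : G) (x : full_shift A G),
      c g x = (b (shift g x) : H) * phi g * (b x : H)^-1.
Proof.
have [cont cM] := cc.
case: (pickP A) => [a _|A0]; last first.
  (* Over the empty alphabet there is no configuration, as G has a point. *)
  exists (fun=> 1), (@one_fun G H); split; first exact: cst_continuous.
  by move=> g x; have := A0 (x 1).
have [b [bcont bE]] := cocycle_trivialization A G H c cM a oneG cont.
have phiM : {morph (fun g => c g (fun=> a) : H) : g h / g * h}.
  by move=> g h; exact: cM.
pose phiMixin := isMultiplicative.Build G H (fun g => c g (fun=> a) : H) phiM.
pose phi : {multiplicative G -> H} :=
  HB.pack (fun g => c g (fun=> a) : H) phiMixin.
by exists b, phi.
Qed.
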